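(* Let $F$ be a field and $\xi\in F$, and let $(\mathcal K_i)_{i\ge0}$ be one of the families $(\mathcal P_i)$, $(\mathcal B_i)$, $(\mathcal{PB}_i)$. If $n\ge 0$ and $M=0$ (that is, there is no $m$ with $1\le m\le n$ and $\xi^m=1$), then $$e^\xi(\mathcal K_n)=n!\cdot\sum_{\mu\vdash n}\ \prod_{i=1}^n\frac{c_1(\mathcal K_i)^{\mu_i}}{\mu_i!\,(i!)^{\mu_i}}.$$ The numbers $e^\xi(\mathcal K_n)$ satisfy the recurrence $$e^\xi(\mathcal K_0)=1,\qquad e^\xi(\mathcal K_n)=\sum_{m=1}^n\binom{n-1}{m-1}c_1(\mathcal K_m)\,e^\xi(\mathcal K_{n-m})\quad\text{for }n\ge1.$$
   Context: Write $\mathbf n=\{1,\dots,n\}$ and let $\mathbf n'$ be a disjoint copy. $\mathcal P_n$ is the monoid of all set partitions $\alpha$ (into non-empty blocks) of $\mathbf n\cup\mathbf n'$. Product: for $\alpha,\beta\in\mathcal P_n$ take a third copy $\mathbf n''$; relabel each lower vertex $x'$ of $\alpha$ as $x''$ and each upper vertex $x$ of $\beta$ as $x''$, and take the union graph $\Gamma(\alpha,\beta)$ on $\mathbf n\cup\mathbf n'\cup\mathbf n''$ (a partition being represented by a graph whose connected components are its blocks); $x,y\in\mathbf n\cup\mathbf n'$ are in the same block of $\alpha\beta$ iff they are joined by a path in $\Gamma(\alpha,\beta)$. $\mathcal{PB}_n$ is the submonoid of partitions all of whose blocks have size at most $2$, and $\mathcal B_n$ the submonoid of partitions all of whose blocks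 have size exactly $2$. $\mathcal P_0=\mathcal B_0=\mathcal{PB}_0=\{\emptyset\}$. The partition algebra $\mathcal P_n^\xi$ is the $F$-algebra with basis $\mathcal P_n$ and product given on basis elements by $\alpha\circ\beta=\xi^{m(\alpha,\beta)}(\alpha\beta)$, where $m(\alpha,\beta)$ is the number of connected components of $\Gamma(\alpha,\beta)$ entirely contained in $\mathbf n''$ (with $\xi^0=1$). $e^\xi(\mathcal K_n)$ is the number of $\alpha\in\mathcal K_n$ with $\alpha\circ\alpha=\alpha$. $M=m$ if $\xi$ is a root of unity of order $m\le n$, and $M=0$ otherwise. The rank of $\alpha$ is the number of blocks meeting both $\mathbf n$ and $\mathbf n'$. $\ker^\wedge(\alpha)$ (resp. $\ker_\vee(\alpha)$) is the equivalence on $\mathbf n$ relating $x,y$ iff $x,y$ (resp. $x',y'$) are in the same block of $\alpha$; $\ker(\alpha)=\ker^\wedge(\alpha)\vee\ker_\vee(\alpha)$ is the smallest equivalence containing both; $\alpha$ is irreducible if $\ker(\alpha)=\mathbf n\times\mathbf n$. $c_1(\mathcal K_n)$ is the number of irreducible $\alpha\in\mathcal K_n$ with $\alpha^2=\alpha$ (product in $\mathcal P_n$) and $\operatorname{rank}(\alpha)=1$. $\mu\vdash n$ means $\mu$ is an integer partition of $n$, with $\mu_i$ parts equal to $i$. Convention: $0^0=1$. *)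

(* Defs.v *)
From HB Require Import structures.
From mathcomp Require Import all_boot all_order all_algebra.

Set Implicit Arguments.
Unset Strict Implicit.
Unset Printing Implicit Defensive.

Import GRing.Theory.
Local Open Scope ring_scope.

(* Vertices: [inl x] is the upper vertex x, [inr x] the lower vertex x'. *)
Notation vertex n := ('I_n + 'I_n)%type.

Definition setpart (n : nat) : predArgType :=
  {P : {set {set vertex n}} | partition P [set: vertex n]}.

Definition blocks n (a : setpart n) : {set {set vertex n}} := val a.

Definition same_block n (a : setpart n) : rel (vertex n) :=
  [rel x y | y \in pblock (blocks a) x].

Lemma same_block_equiv n (a : setpart n) : equivalence_rel (same_block a).
Proof.
case/and3P: (valP a) => /eqP covP tiP _ x y z; split=> [|xy].
  by rewrite /same_block /= mem_pblock covP inE.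
by rewrite /same_block /= (same_pblock tiP xy).
Qed.

(* Vertices of the product graph: [inl v] is the outer vertex v, and [inr x]
   is the middle vertex x''. *)
Notation gvertex n := ('I_n + 'I_n + 'I_n)%type.

Definition top_emb n (v : vertex n) : gvertex n :=
  match v with inl x => inl (inl x) | inr x => inr x end.

Definition bot_emb n (v : vertex n) : gvertex n :=
  match v with inl x => inr x | inr x => inl (inr x) end.

(* A partition is represented by the graph joining any two vertices of a common
   block. *)
Definition gamma n (a b : setpart n) : rel (gvertex n) := [rel u v |
  [exists x, exists y,
    [&& same_block a x y, u == top_emb x & v == top_emb y]] ||
  [exists x, exists y,
    [&& same_block b x y, u == bot_emb x & v == bot_emb y]]].

Lemma gamma_sym n (a b : setpart n) : symmetric (gamma a b).
Proof.
have sbC (c : setpart n) x y : same_block c x y = same_block c y x.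
  have eqc := same_block_equiv c.
  apply/idP/idP=> xy.
    by rewrite -(eqc x y x).2 //; exact: (eqc x x x).1.
  by rewrite -(eqc y x y).2 //; exact: (eqc y y y).1.
have half (c : setpart n) (f : vertex n -> gvertex n) u v :
    [exists x, exists y, [&& same_block c x y, u == f x & v == f y]] ->
    [exists x, exists y, [&& same_block c x y, v == f x & u == f y]].
  case/existsP=> x /existsP[y /and3P[xy ux vy]].
  by apply/existsP; exists y; apply/existsP; exists x; rewrite sbC xy ux vy.
by move=> u v; apply/orP/orP; case=> /half; auto.
Qed.

Lemma connect_gamma_equiv n (a b : setpart n) :
  equivalence_rel (connect (gamma a b)).
Proof.
have symG: connect_sym (gamma a b).
  by apply: sym_connect_sym; exact: gamma_sym.
by move=> x y z; split=> [|xy]; [exact: connect0 | exact: (same_connect symG)].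
Qed.

Definition prod_blocks n (a b : setpart n) : {set {set vertex n}} :=
  equivalence_partition (fun x y => connect (gamma a b) (inl x) (inl y))
    [set: vertex n].

Lemma prod_blocks_partition n (a b : setpart n) :
  partition (prod_blocks a b) [set: vertex n].
Proof.
by apply: equivalence_partitionP => x y z _ _ _; exact: connect_gamma_equiv.
Qed.

Definition pmul n (a b : setpart n) : setpart n :=
  Sub (prod_blocks a b) (prod_blocks_partition a b).

Lemma same_block_pmul n (a b : setpart n) x y :
  same_block (pmul a b) x y = connect (gamma a b) (inl x) (inl y).
Proof.
apply: (@pblock_equivalence_partition _
  (fun x y => connect (gamma a b) (inl x) (inl y)) setT); rewrite ?inE //.
by move=> u v w _ _ _; exact: connect_gamma_equiv.
Qed.

Definition gamma_components n (a b : setpart n) : {set {set gvertex n}} :=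
  equivalence_partition (connect (gamma a b)) [set: gvertex n].

(* m(a, b) *)
Definition nfloat n (a b : setpart n) : nat :=
  #|[set C in gamma_components a b |
      C \subset [set (inr x : gvertex n) | x : 'I_n]]|.

(* The partition algebra: an element is the function of its coordinates in the
   basis of set partitions, and [palg_mul] is the bilinear product. *)
Notation palg F n := {ffun setpart n -> F^o}.

(* Locked, because unification otherwise unfolds the enumeration of set
   partitions. *)
HB.lock Definition pbasis (F : fieldType) n (a : setpart n) : palg F n :=
  [ffun b => (b == a)%:R].

Definition palg_mul (F : fieldType) (xi : F) n (u v : palg F n) : palg F n :=
  \sum_(a : setpart n) \sum_(b : setpart n)
     ((u a : F) * (v b : F) * xi ^+ nfloat a b) *: pbasis F (pmul a b).

Lemma palg_mul_basis (F : fieldType) (xi : F) n (a b : setpart n) :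
  palg_mul xi (pbasis F a) (pbasis F b) =
  xi ^+ nfloat a b *: pbasis F (pmul a b).
Proof.
have bE c d : (pbasis F c d : F) = if d == c then 1 else 0.
  by rewrite unlock ffunE; case: eqP.
rewrite /palg_mul (bigD1 a) //= [X in _ + X]big1 => [|c ca]; last first.
  apply: big1 => d _; have -> : (pbasis F a c : F) = 0 by rewrite bE ifN.
  by rewrite !mul0r scale0r.
rewrite addr0 (bigD1 b) //= [X in _ + X]big1 => [|d db]; last first.
  have -> : (pbasis F b d : F) = 0 by rewrite bE ifN.
  by rewrite mulr0 mul0r scale0r.
have -> : (pbasis F a a : F) = 1 by rewrite bE eqxx.
have -> : (pbasis F b b : F) = 1 by rewrite bE eqxx.
by rewrite addr0 mulr1 mul1r.
Qed.

Inductive monoid_family := PartitionF | BrauerF | PartialBrauerF.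

Definition in_family (K : monoid_family) n (a : setpart n) : bool :=
  match K with
  | PartitionF => true
  | BrauerF => [forall B in blocks a, #|B| == 2%N]
  | PartialBrauerF => [forall B in blocks a, (#|B| <= 2)%N]
  end.

Definition e_xi (F : fieldType) (xi : F) (K : monoid_family) n : nat :=
  #|[set a : setpart n |
      in_family K a && (palg_mul xi (pbasis F a) (pbasis F a) == pbasis F a)]|.

(* The number M: the order of xi if it is at most n, and 0 otherwise. *)
Definition root_order (F : fieldType) (xi : F) n : nat :=
  if [pick m : 'I_n.+1 | m.-primitive_root xi] is Some m then m else 0%N.

Lemma root_order_eq0P (F : fieldType) (xi : F) n :
  root_order xi n = 0%N <-> ~ exists m, (1 <= m <= n)%N /\ xi ^+ m = 1.
Proof.
rewrite /root_order; case: pickP => [m mP | noM]; split.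
- by move=> m0; have := prim_order_gt0 mP; rewrite m0.
- case; exists m; rewrite (prim_order_gt0 mP) -ltnS ltn_ord.
  by split=> //; exact: prim_expr_order.
- move=> _ [m [/andP[m_gt0 lemn] /(prim_order_exists m_gt0)[d dP dm]]].
  have ltdn: (d < n.+1)%N by rewrite ltnS (leq_trans (dvdn_leq m_gt0 dm)).
  by have := noM (Ordinal ltdn); rewrite /= dP.
- by [].
Qed.

Definition prank n (a : setpart n) : nat :=
  #|[set B in blocks a |
      [exists x : 'I_n, inl x \in B] && [exists x : 'I_n, inr x \in B]]|.

Definition ker_upper n (a : setpart n) : rel 'I_n :=
  [rel x y | same_block a (inl x) (inl y)].

Definition ker_lower n (a : setpart n) : rel 'I_n :=
  [rel x y | same_block a (inr x) (inr y)].

(* The join of two equivalences is the reflexive transitive closure of their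
   union. *)
Definition ker_join n (a : setpart n) : rel 'I_n :=
  connect (relU (ker_upper a) (ker_lower a)).

Definition pirreducible n (a : setpart n) : bool :=
  [forall x, forall y, ker_join a x y].

Definition c1 (K : monoid_family) n : nat :=
  #|[set a : setpart n |
      [&& in_family K a, pirreducible a, pmul a a == a & prank a == 1%N]]|.

Definition is_intpart (n : nat) (s : seq nat) : bool :=
  [&& sorted geq s, 0%N \notin s & sumn s == n].

(* Integer partitions of n as a finite type: all parts, and the number of
   parts, are at most n. *)
Definition intpart (n : nat) : predArgType :=
  {s : n.-bseq 'I_n.+1 | is_intpart n (map val s)}.

Definition parts n (mu : intpart n) : seq nat := map val (val mu).

Definition multiplicity n (mu : intpart n) (i : nat) : nat := count_mem i (parts mu).

Lemma intpart_parts n (s : seq nat) :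
  is_intpart n s <-> exists mu : intpart n, parts mu = s.
Proof.
split=> [sP | [mu <-]]; last exact: (valP mu).
have [_ s0 /eqP sumE] := and3P sP.
have les : (size s <= n)%N.
  rewrite -{}sumE; elim: s s0 {sP} => //= x s IH.
  rewrite inE negb_or eq_sym -lt0n => /andP[x0 /IH]; rewrite -add1n.
  exact: leq_add.
have bds : all (ltn^~ n.+1) s.
  rewrite -{}sumE {les s0 sP}; apply/allP=> x xs; rewrite /= ltnS.
  by rewrite (perm_sumn (perm_to_rem xs)) /= leq_addr.
pose t : seq 'I_n.+1 := map inord s.
have tE : map val t = s.
  rewrite -map_comp -[RHS]map_id; apply/eq_in_map => x /(allP bds) /= x_lt.
  by rewrite inordK.
have szt : (size t <= n)%N by rewrite size_map.
have tP : is_intpart n (map val (Bseq szt)) by rewrite /= tE.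
by exists (exist _ (Bseq szt) tP); rewrite /parts /= tE.
Qed.

(* Main.v *)
Require Import Defs.
From mathcomp Require Import all_boot all_order all_algebra ring.

(** Why the theorem holds.

    Since xi is not a root of unity of order at most n and at most n
    components of the product graph float in the middle row, a basis element a
    is idempotent for the twisted product iff a is idempotent in the partition
    monoid and nothing floats ([xi_idempotentE]).  This holds iff every
    transversal block of a lies over a single class of the kernel join of a, and
    every class carries exactly one of them ([idempotent_nfloatE]): the classes are the connected components
    of the middle row, a class without a transversal floats, and two
    transversals in one class are merged by squaring.  When there is only one
    class, the condition says that the rank is 1, so c_1 counts the irreducible
    partitions that satisfy it ([irr_rank1E]).

    The characterization mentions no product and is local to the kernel
    classes.  A partition satisfying it is hence the union of an irreducible one
    on the kernel class of a chosen point and an arbitrary one on the other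
    points ([card_diagrams_class]); the counts depend only on the number of
    points ([card_diagramsE]), and the choices of a class of size m containing
    the chosen point give the binomial coefficient of the recurrence
    ([diagrams_recurrence]).

    The closed formula is the exponential formula.  Let h n be the sum over the
    integer partitions of n.  In n * h n, write n as the sum of the parts of the
    partition; removing one part equal to m leaves a partition of n - m, which
    expresses n * h n through the h (n - m) ([intpart_sum_rec]).  For
    n! * h n this is the recurrence divided by (n - 1)!. *)

Set Implicit Arguments.
Unset Strict Implicit.
Unset Printing Implicit Defensive.

(** * Diagrams with one transversal block in each kernel class *)

Definition underlying (T : Type) (v : T + T) : T :=
  match v with inl x => x | inr x => x end.

Definition doubled (T : finType) (A : {set T}) : {set T + T} :=
  [set v | underlying v \in A].

(** On a partition this is the relation of lying in a common block; it is stated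
    without [pblock] because it is also used for points outside the cover, and
    because it distributes over unions of sets of blocks. *)
Definition linked (V : finType) (P : {set {set V}}) : rel V :=
  fun u v => [exists B in P, (u \in B) && (v \in B)].

Definition kstep (T : finType) (P : {set {set T + T}}) : rel T :=
  fun x y => linked P (inl x) (inl y) || linked P (inr x) (inr y).

(** The join of the upper and the lower kernel.  Through blocks do not contribute:
    a permutation has the discrete join. *)
Definition kjoin (T : finType) (P : {set {set T + T}}) : rel T :=
  connect (kstep P).

Definition through (T : finType) (P : {set {set T + T}}) : rel T :=
  fun x y => linked P (inl x) (inr y).

(** The description of an idempotent without floating component that does not
    mention products (see [idempotent_nfloatE]). *)
Definition unithrough (T : finType) (P : {set {set T + T}}) (A : {set T}) :=
  [&& [forall x, forall y, through P x y ==> kjoin P x y],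
      [forall x in A, exists y, exists z, kjoin P x y && through P y z] &
      [forall x, forall y, forall x', forall y',
        [&& through P x x', through P y y' & kjoin P x y]
        ==> linked P (inl x) (inl y)]].

Definition size_ok (K : monoid_family) (T : finType) (P : {set {set T}}) :=
  match K with
  | PartitionF => true
  | BrauerF => [forall B in P, #|B| == 2]
  | PartialBrauerF => [forall B in P, #|B| <= 2]
  end.

(** Counting is done over the subsets [A] of a fixed type, so that a diagram and
    its restrictions to subsets have the same type and gluing is a union of
    sets of blocks. *)
Definition diagrams K (T : finType) (A : {set T}) : {set {set {set T + T}}} :=
  [set P | [&& partition P (doubled A), size_ok K P & unithrough P A]].

Definition irr_diagrams K (T : finType) (A : {set T}) :=
  [set P in diagrams K A | [forall x in A, forall y in A, kjoin P x y]].

Lemma connect_ind (T : finType) (e : rel T) (p : pred T) x y :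
  (forall u v, p u -> e u v -> p v) -> p x -> connect e x y -> p y.
Proof.
move=> pe px /connectP[s es ->{y}].
by elim: s x px es => //= z s IH x px /andP[xz]; apply: IH; apply: pe xz.
Qed.

Lemma linkedP (V : finType) (P : {set {set V}}) u v :
  reflect (exists B, [/\ B \in P, u \in B & v \in B]) (linked P u v).
Proof.
apply: (iffP existsP) => -[B].
  by case/and3P; exists B.
by case=> *; exists B; apply/and3P.
Qed.

Lemma linked_sym (V : finType) (P : {set {set V}}) : symmetric (linked P).
Proof.
by move=> u v; apply/linkedP/linkedP=> -[B [? ? ?]]; exists B.
Qed.

Lemma linked_cover (V : finType) (P : {set {set V}}) u v :
  linked P u v -> u \in cover P.
Proof. by case/linkedP=> B [BP uB _]; apply/bigcupP; exists B. Qed.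

Lemma linked_refl (V : finType) (P : {set {set V}}) u :
  u \in cover P -> linked P u u.
Proof. by case/bigcupP=> B BP uB; apply/linkedP; exists B. Qed.

Lemma linked_trans (V : finType) (P : {set {set V}}) :
  trivIset P -> transitive (linked P).
Proof.
move=> tiP v u w /linkedP[B [BP uB vB]] /linkedP[C [CP vC wC]].
apply/linkedP; exists B; split=> //.
by rewrite -(def_pblock tiP BP vB) (def_pblock tiP CP vC).
Qed.

Lemma linkedU (V : finType) (P Q : {set {set V}}) u v :
  linked (P :|: Q) u v = linked P u v || linked Q u v.
Proof.
apply/linkedP/orP.
  case=> B [+ uB vB]; rewrite inE => /orP[BP|BQ]; [left|right];
  by apply/linkedP; exists B.
by case=> /linkedP[B [BP uB vB]]; exists B; split=> //; rewrite inE BP ?orbT.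
Qed.

Lemma kstep_sym (T : finType) (P : {set {set T + T}}) : symmetric (kstep P).
Proof. by move=> x y; rewrite /kstep linked_sym (linked_sym P (inr x)). Qed.

Lemma kjoin_sym (T : finType) (P : {set {set T + T}}) : symmetric (kjoin P).
Proof. exact/sym_connect_sym/kstep_sym. Qed.

Lemma kjoin_trans (T : finType) (P : {set {set T + T}}) : transitive (kjoin P).
Proof. exact: connect_trans. Qed.

Lemma unithroughP (T : finType) (P : {set {set T + T}}) (A : {set T}) :
  reflect
    [/\ forall x y, through P x y -> kjoin P x y,
        forall x, x \in A -> exists y z, kjoin P x y /\ through P y z &
        forall x y x' y', through P x x' -> through P y y' -> kjoin P x y ->
          linked P (inl x) (inl y)]
    (unithrough P A).
Proof.
apply: (iffP and3P) => -[H1 H2 H3]; split.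
- by move=> x y; move/forallP/(_ x)/forallP/(_ y)/implyP: H1.
- move=> x xA; move/forall_inP/(_ x xA): H2.
  by case/existsP=> y /existsP[z /andP[? ?]]; exists y, z.
- move=> x y x' y' tx ty xy.
  move/forallP/(_ x)/forallP/(_ y)/forallP/(_ x')/forallP/(_ y')/implyP: H3.
  by apply; rewrite tx ty xy.
- by apply/forallP=> x; apply/forallP=> y; apply/implyP/H1.
- apply/forall_inP=> x /H2[y [z [xy yz]]].
  by apply/existsP; exists y; apply/existsP; exists z; rewrite xy.
- apply/forallP=> x; apply/forallP=> y; apply/forallP=> x'; apply/forallP=> y'.
  by apply/implyP=> /and3P[]; apply: H3.
Qed.

(** * Splitting off a kernel class *)

Section Split.
Variables (T : finType).
Implicit Types (A B C : {set T}) (P Q R : {set {set T + T}}).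

Lemma linked_doubled P A u v :
  partition P (doubled A) -> linked P u v -> (underlying u \in A) && (underlying v \in A).
Proof.
case/and3P=> /eqP covP _ _ uv.
have := linked_cover uv; rewrite linked_sym in uv; have := linked_cover uv.
by rewrite covP !inE => -> ->.
Qed.

Lemma kstep_in P A x y :
  partition P (doubled A) -> kstep P x y -> (x \in A) && (y \in A).
Proof. by move=> parP /orP[] /(linked_doubled parP). Qed.

Lemma kjoin_in P A x y :
  partition P (doubled A) -> kjoin P x y -> x \in A -> y \in A.
Proof.
move=> parP xy xA; apply: connect_ind xA xy => u v _.
by case/(kstep_in parP)/andP.
Qed.

Lemma partition_doubledU B C Q R :
  [disjoint B & C] -> partition Q (doubled B) -> partition R (doubled C) ->
  partition (Q :|: R) (doubled (B :|: C)).
Proof.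
move=> dBC /and3P[/eqP covQ tiQ nQ] /and3P[/eqP covR tiR nR].
have covU : cover (Q :|: R) = doubled (B :|: C).
  rewrite /cover bigcup_setU -![\bigcup_(_ in _) _]/(cover _) covQ covR.
  by apply/setP=> v; rewrite !inE.
apply/and3P; split; first by rewrite covU.
  apply: trivIsetU => //; rewrite covQ covR.
  rewrite disjoints_subset; apply/subsetP=> v; rewrite !inE => vB.
  by rewrite (disjointFr dBC).
by rewrite inE negb_or nQ.
Qed.

Definition restrict P B := [set b in P | b \subset doubled B].

Lemma restrictU B C Q R :
  [disjoint B & C] -> partition Q (doubled B) -> partition R (doubled C) ->
  restrict (Q :|: R) B = Q.
Proof.
move=> dBC parQ parR; apply/setP=> b; rewrite !inE.
apply/andP/idP => [[/orP[//|bR] sbB]|bQ].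
  have [v vb] : exists v, v \in b.
    by apply/set0Pn; apply: contraTneq bR => ->; case/and3P: parR.
  have /linked_doubled : linked R v v by apply/linkedP; exists b.
  move/(_ _ parR)/andP=> [vC _].
  have := subsetP sbB _ vb; rewrite inE => vB.
  by rewrite (disjointFr dBC) in vC.
split; first by rewrite bQ.
apply/subsetP=> v vb.
have /linked_doubled : linked Q v v by apply/linkedP; exists b.
by move/(_ _ parQ)/andP=> [vB _]; rewrite inE.
Qed.

Lemma partition_restrict P A B :
  partition P (doubled A) -> B \subset A ->
  (forall u v, linked P u v -> (underlying u \in B) = (underlying v \in B)) ->
  partition (restrict P B) (doubled B).
Proof.
case/and3P=> /eqP covP tiP nP sBA satB; apply/and3P; split.
- rewrite eqEsubset; apply/andP; split.
    by apply/bigcupsP=> b; rewrite inE => /andP[].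
  apply/subsetP=> v; rewrite inE => vB.
  have : v \in cover P by rewrite covP inE (subsetP sBA).
  case/bigcupP=> b bP vb; apply/bigcupP; exists b => //; rewrite inE bP /=.
  apply/subsetP=> w wb; rewrite inE -(satB v w) //.
  by apply/linkedP; exists b.
- by apply: trivIsetS tiP; apply/subsetP=> b; rewrite inE => /andP[].
- by rewrite inE (negPf nP).
Qed.

Lemma restrict_split P A B :
  partition P (doubled A) -> B \subset A ->
  (forall u v, linked P u v -> (underlying u \in B) = (underlying v \in B)) ->
  restrict P B :|: restrict P (A :\: B) = P.
Proof.
case/and3P=> /eqP covP tiP nP sBA satB; apply/setP=> b; rewrite !inE -andb_orr.
case bP: (b \in P) => //=; apply/orP.
have [v vb] : exists v, v \in b.
  by apply/set0Pn; apply: contraTneq bP => ->.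
have lnk w : w \in b -> linked P v w by move=> wb; apply/linkedP; exists b.
case vB: (underlying v \in B); [left|right]; apply/subsetP=> w wb; rewrite !inE.
  by rewrite -(satB v w) ?vB ?lnk.
rewrite -(satB v w) ?vB ?lnk //=.
have /linked_cover : linked P w v by rewrite linked_sym lnk.
by rewrite covP inE.
Qed.

Section Glue.
Variables (B C : {set T}) (Q R : {set {set T + T}}).
Hypotheses (dBC : [disjoint B & C]).
Hypotheses (parQ : partition Q (doubled B)) (parR : partition R (doubled C)).

Lemma linkedUl u v :
  underlying u \in B -> linked (Q :|: R) u v = linked Q u v.
Proof.
move=> uB; rewrite linkedU; case: (linked Q u v) => //=.
by apply/negbTE/negP=> /(linked_doubled parR)/andP[]; rewrite (disjointFr dBC uB).
Qed.

(** No block of [R] meets [B], so a path of kernel steps that starts in [B] uses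
    blocks of [Q] only. *)
Lemma kjoinUl x y : x \in B -> kjoin (Q :|: R) x y = kjoin Q x y.
Proof.
move=> xB; apply/idP/idP; last first.
  apply: connect_sub => u v uv; apply: connect1.
  by rewrite /kstep !linkedU; case/orP: uv => ->; rewrite ?orbT.
apply: connect_ind; last exact: connect0.
move=> u v xu uv; apply: (connect_trans xu); apply: connect1.
have uB := kjoin_in parQ xu xB.
by move: uv; rewrite /kstep !linkedUl.
Qed.
End Glue.

(** Each clause of [unithrough] speaks of one kernel class, and the kernel classes
    of the points of [B] are those of [Q]. *)
Lemma unithroughUl B C Q R :
  [disjoint B & C] -> partition Q (doubled B) -> partition R (doubled C) ->
  unithrough (Q :|: R) (B :|: C) -> unithrough Q B.
Proof.
move=> dBC parQ parR /unithroughP[S E U].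
have thr x y : through Q x y -> [/\ x \in B, y \in B & through (Q :|: R) x y].
  move=> xy; case/andP: (linked_doubled parQ xy) => -> ->; move: xy.
  by rewrite /through linkedU => ->.
apply/unithroughP; split.
- by move=> x y /thr[xB _ /S]; rewrite (kjoinUl dBC parQ parR).
- move=> x xB; have [|y [z []]] := E x; first by rewrite inE xB.
  rewrite (kjoinUl dBC parQ parR) // => xy.
  by rewrite /through (linkedUl Q dBC parR) ?(kjoin_in parQ xy) //; exists y, z.
- move=> x y x' y' /thr[xB _ txx] /thr[yB _ tyy] xy.
  rewrite -(linkedUl Q dBC parR) //; apply: U txx tyy _.
  by rewrite (kjoinUl dBC parQ parR).
Qed.

Lemma unithroughU B C Q R :
  [disjoint B & C] -> partition Q (doubled B) -> partition R (doubled C) ->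
  unithrough (Q :|: R) (B :|: C) = unithrough Q B && unithrough R C.
Proof.
move=> dBC parQ parR; apply/idP/andP => [H|[]].
  split; first exact: unithroughUl H.
  rewrite setUC (setUC B) in H; rewrite disjoint_sym in dBC.
  exact: unithroughUl H.
have dCB : [disjoint C & B] by rewrite disjoint_sym.
have kB := kjoinUl dBC parQ parR; have kC := kjoinUl dCB parR parQ.
rewrite (setUC R Q) in kC.
have lB := linkedUl Q dBC parR; have lC := linkedUl R dCB parQ.
rewrite (setUC R Q) in lC.
move=> /unithroughP[SQ EQ UQ] /unithroughP[SR ER UR].
have inU x y : through (Q :|: R) x y -> x \in B \/ x \in C.
  by rewrite /through linkedU => /orP[/(linked_doubled parQ)|/(linked_doubled parR)]
    /andP[xB _]; auto.
apply/unithroughP; split.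
- move=> x y xy; case: (inU _ _ xy) => [xB|xC].
    by rewrite kB //; apply: SQ; rewrite /through -lB.
  by rewrite kC //; apply: SR; rewrite /through -lC.
- move=> x; rewrite inE => /orP[xB|xC].
    have [y [z [xy yz]]] := EQ x xB; exists y, z.
    by rewrite kB // /through lB // (kjoin_in parQ xy).
  have [y [z [xy yz]]] := ER x xC; exists y, z.
  by rewrite kC // /through lC // (kjoin_in parR xy).
- move=> x y x' y' tx ty; case: (inU _ _ tx) => [xB|xC].
    rewrite kB ?lB // => xy; have yB := kjoin_in parQ xy xB.
    by apply: (UQ x y x' y') => //; rewrite /through -lB.
  rewrite kC ?lC // => xy; have yC := kjoin_in parR xy xC.
  by apply: (UR x y x' y') => //; rewrite /through -lC.
Qed.

Lemma size_okU K Q R : size_ok K (Q :|: R) = size_ok K Q && size_ok K R.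
Proof.
have all_U (p : pred {set T + T}) :
    [forall b in Q :|: R, p b] = [forall b in Q, p b] && [forall b in R, p b].
  apply/forall_inP/andP => [H|[/forall_inP HQ /forall_inP HR] b].
    by split; apply/forall_inP=> b bP; apply: H; rewrite inE bP ?orbT.
  by rewrite inE => /orP[/HQ|/HR].
by case: K; rewrite /= ?all_U.
Qed.

(** The underlying points of any block lie in one kernel class, by definition for
    two points of the same row, and by the first clause of [unithrough] for a
    through block.  Hence a kernel class is a union of blocks. *)
Lemma linked_kjoin P A u v :
  unithrough P A -> linked P u v -> kjoin P (underlying u) (underlying v).
Proof.
case/unithroughP=> S _ _.
case: u => x; case: v => y /= xy.
- by apply: connect1; rewrite /kstep xy.
- exact: S.
- by rewrite kjoin_sym; apply: S; rewrite /through linked_sym.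
- by apply: connect1; rewrite /kstep xy orbT.
Qed.

Definition kclass P x : {set T} := [set y | kjoin P x y].

(** Taking unions is a bijection from the pairs of an irreducible diagram on [B]
    and a diagram on the complement: the parts are recovered as the blocks
    contained in each side, and each side is a union of blocks because [B] is a
    kernel class. *)
Lemma card_diagrams_class K A B x0 :
  x0 \in B -> B \subset A ->
  #|[set P in diagrams K A | kclass P x0 == B]| =
    #|irr_diagrams K B| * #|diagrams K (A :\: B)|.
Proof.
move=> x0B sBA; set C := A :\: B.
have dBC : [disjoint B & C].
  by rewrite disjoints_subset; apply/subsetP=> x xB; rewrite !inE xB.
have defA : B :|: C = A by have := setID A B; rewrite (setIidPr sBA).
rewrite -cardsX.
pose glue (QR : {set {set T + T}} * {set {set T + T}}) := QR.1 :|: QR.2.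
have inj : {in setX (irr_diagrams K B) (diagrams K C) &, injective glue}.
  case=> [Q1 R1] [Q2 R2]; rewrite !inE /glue /=.
  case/andP=> /andP[/and3P[pQ1 _ _] _] /and3P[pR1 _ _].
  case/andP=> /andP[/and3P[pQ2 _ _] _] /and3P[pR2 _ _] eqU.
  have dCB : [disjoint C & B] by rewrite disjoint_sym.
  congr (_, _).
    by rewrite -(restrictU dBC pQ1 pR1) eqU (restrictU dBC pQ2 pR2).
  by rewrite -(restrictU dCB pR1 pQ1) setUC eqU setUC (restrictU dCB pR2 pQ2).
rewrite -(card_in_imset inj); apply: eq_card => P; rewrite inE.
apply/andP/imsetP => [[]|[[Q R] + ->{P}]]; last first.
  rewrite !inE /glue /= => /andP[/andP[/and3P[pQ sQ uQ] /forall_inP irrQ]].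
  case/and3P=> pR sR uR.
  split.
    apply/and3P; split.
    + by rewrite -defA; apply: partition_doubledU.
    + by rewrite size_okU sQ.
    + by rewrite -defA unithroughU // uQ.
  apply/eqP/setP=> y; rewrite inE (kjoinUl dBC pQ pR) //.
  apply/idP/idP => [xy|yB]; first exact: kjoin_in xy x0B.
  exact: (forall_inP (irrQ _ x0B)).
rewrite inE => /and3P[parP sP uP] /eqP defB.
have satB u v : linked P u v -> (underlying u \in B) = (underlying v \in B).
  move=> /(linked_kjoin uP) uv; rewrite -defB !inE.
  apply/idP/idP=> H; apply: (kjoin_trans H) => //.
  by rewrite kjoin_sym.
have satC u v : linked P u v -> (underlying u \in C) = (underlying v \in C).
  move=> uv; rewrite !inE (satB _ _ uv).
  by case/andP: (linked_doubled parP uv) => -> ->.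
have sCA : C \subset A by rewrite subsetDl.
have splitP : restrict P B :|: restrict P C = P.
  exact: restrict_split parP sBA satB.
have pQ := partition_restrict parP sBA satB.
have pR := partition_restrict parP sCA satC.
exists (restrict P B, restrict P C); last by rewrite /glue /= splitP.
have /andP[sQ sR] : size_ok K (restrict P B) && size_ok K (restrict P C).
  by rewrite -size_okU splitP.
have /andP[uQ uR] : unithrough (restrict P B) B && unithrough (restrict P C) C.
  by rewrite -unithroughU // splitP defA.
rewrite !inE /= pQ sQ uQ pR sR uR !andbT /=.
apply/forall_inP=> x xB; apply/forall_inP=> y yB.
rewrite -(kjoinUl dBC pQ pR) // splitP.
have := xB; have := yB; rewrite -defB !inE => x0y x0x.
by apply: kjoin_trans x0y; rewrite kjoin_sym.
Qed.

Lemma card_diagrams_rec K A x0 :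
  x0 \in A ->
  #|diagrams K A| = \sum_(B : {set T} | (x0 \in B) && (B \subset A))
     #|irr_diagrams K B| * #|diagrams K (A :\: B)|.
Proof.
move=> x0A.
rewrite -sum1_card.
rewrite (partition_big (kclass^~ x0)
  (fun B => (x0 \in B) && (B \subset A))) => [|P]; last first.
  rewrite inE => /and3P[parP _ _]; rewrite /= inE /kjoin connect0 /=.
  by apply/subsetP=> y; rewrite inE => /(kjoin_in parP); apply.
apply: eq_bigr => B /andP[x0B sBA].
rewrite -(card_diagrams_class K x0B sBA) -sum1_card.
by apply: eq_bigl => P; rewrite inE.
Qed.

End Split.

(** * Invariance under relabelling *)

Definition vmap (S T : Type) (f : S -> T) (v : S + S) : T + T :=
  match v with inl x => inl (f x) | inr x => inr (f x) end.

Definition relabel (S T : finType) (f : S -> T) (P : {set {set S + S}}) :=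
  [set vmap f @: (B : {set S + S}) | B in P].

Section Relabel.
Variables (S T : finType) (f : S -> T).
Hypothesis f_inj : injective f.
Implicit Types (A : {set S}) (P : {set {set S + S}}).

Lemma underlying_vmap v : underlying (vmap f v) = f (underlying v).
Proof. by case: v. Qed.

Lemma vmap_inj : injective (vmap f).
Proof. by case=> x [] y //= [] /f_inj->. Qed.

Lemma relabel_inj : injective (relabel f).
Proof. exact/imset_inj/imset_inj/vmap_inj. Qed.

Lemma linked_relabel P u v :
  linked (relabel f P) (vmap f u) (vmap f v) = linked P u v.
Proof.
apply/linkedP/linkedP=> [[_ [/imsetP[B BP ->]]]|[B [BP uB vB]]].
  by rewrite !mem_imset; [exists B | exact: vmap_inj | exact: vmap_inj].
by exists (vmap f @: B); rewrite !imset_f.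
Qed.

Lemma linked_relabelP P u v :
  linked (relabel f P) u v ->
  exists u0 v0, [/\ u = vmap f u0, v = vmap f v0 & linked P u0 v0].
Proof.
case/linkedP=> _ [/imsetP[B BP ->] /imsetP[u0 u0B ->] /imsetP[v0 v0B ->]].
by exists u0, v0; split=> //; apply/linkedP; exists B.
Qed.

Lemma kstep_relabel P x y :
  kstep (relabel f P) (f x) (f y) = kstep P x y.
Proof.
by congr (_ || _); [exact: (linked_relabel P (inl x) (inl y))
                   |exact: (linked_relabel P (inr x) (inr y))].
Qed.

Lemma kjoin_relabel P x y :
  kjoin (relabel f P) (f x) (f y) = kjoin P x y.
Proof.
apply/idP/idP=> [|/connectP[s + ->]]; last first.
  elim: s x => [|z s IH] x /=; first by rewrite /kjoin connect0.
  case/andP=> xz /IH; apply: kjoin_trans.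
  by apply: connect1; rewrite kstep_relabel.
pose p z := [exists y, (z == f y) && kjoin P x y].
move=> xy; have /existsP[z /andP[/eqP/f_inj-> //]] : p (f y).
apply: connect_ind xy => [u v /existsP[z /andP[/eqP-> xz]] uv|]; last first.
  by apply/existsP; exists x; rewrite eqxx /kjoin connect0.
have [w defv] : exists w, v = f w.
  by case/orP: uv => /linked_relabelP[u0 [[w|w] [_ // [->] _]]]; exists w.
move: uv; rewrite defv kstep_relabel => zw.
by apply/existsP; exists w; rewrite eqxx /=; apply/(kjoin_trans xz)/connect1.
Qed.

Lemma through_relabel P x y :
  through (relabel f P) (f x) (f y) = through P x y.
Proof. exact: (linked_relabel P (inl x) (inr y)). Qed.

Lemma through_relabelP P x y :
  through (relabel f P) x y ->
  exists x0 y0, [/\ x = f x0, y = f y0 & through P x0 y0].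
Proof.
case/linked_relabelP=> [[x0|x0] [[y0|y0] [//= [->] // [->] xy]]].
by exists x0, y0.
Qed.

Lemma doubled_imset A : doubled (f @: A) = vmap f @: doubled A.
Proof.
apply/setP=> v; rewrite inE; apply/imsetP/imsetP=> [[x xA]|[u uA ->]].
  by case: v => _ /= ->; [exists (inl x) | exists (inr x)]; rewrite // inE.
by rewrite underlying_vmap; exists (underlying u) => //; rewrite inE in uA.
Qed.

Lemma partition_relabel P A :
  partition (relabel f P) (doubled (f @: A)) = partition P (doubled A).
Proof. by rewrite doubled_imset imset_partition //; exact: vmap_inj. Qed.

Lemma size_ok_relabel K P : size_ok K (relabel f P) = size_ok K P.
Proof.
have all_relabel (p : pred nat) :
    [forall B in relabel f P, p #|B|] = [forall B in P, p #|B|].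
  apply/forall_inP/forall_inP=> H B.
    by move=> BP; have := H _ (imset_f _ BP); rewrite card_imset //; apply: vmap_inj.
  by case/imsetP=> C CP ->; rewrite card_imset ?H //; apply: vmap_inj.
case: K => //=; first exact: (all_relabel (fun k => k == 2)).
exact: (all_relabel (fun k => k <= 2)).
Qed.

Lemma unithrough_relabel P A :
  unithrough (relabel f P) (f @: A) = unithrough P A.
Proof.
apply/unithroughP/unithroughP=> -[HS HE HU]; split.
- by move=> x y; rewrite -through_relabel => /HS; rewrite kjoin_relabel.
- move=> x xA; have [y [z [xy yz]]] := HE (f x) (imset_f _ xA).
  have [y0 [z0 [defy defz yz0]]] := through_relabelP yz.
  by exists y0, z0; rewrite -(kjoin_relabel P) -defy.
- move=> x y x' y'; rewrite -(through_relabel P x) -(through_relabel P y).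
  move=> xx yy xy; rewrite -linked_relabel.
  by apply: (HU _ _ _ _ xx yy); rewrite kjoin_relabel.
- move=> x y /through_relabelP[x0 [y0 [-> -> /HS]]].
  by rewrite kjoin_relabel.
- move=> _ /imsetP[x /HE[y [z [xy yz]]] ->].
  by exists (f y), (f z); rewrite kjoin_relabel through_relabel.
- move=> x1 y1 x2 y2 /through_relabelP[x [x' [-> _ xx]]].
  move=> /through_relabelP[y [y' [-> _ yy]]]; rewrite kjoin_relabel => xy.
  by rewrite (linked_relabel P (inl x) (inl y)); apply: HU xy; eassumption.
Qed.

Lemma mem_diagrams_relabel K P A :
  (relabel f P \in diagrams K (f @: A)) = (P \in diagrams K A).
Proof.
by rewrite !inE partition_relabel size_ok_relabel unithrough_relabel.
Qed.

Lemma mem_irr_diagrams_relabel K P A :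
  (relabel f P \in irr_diagrams K (f @: A)) = (P \in irr_diagrams K A).
Proof.
rewrite inE [RHS]inE mem_diagrams_relabel; congr (_ && _).
apply/forall_inP/forall_inP=> H.
  move=> x xA; apply/forall_inP=> y yA; rewrite -kjoin_relabel.
  by apply: (forall_inP (H _ _)); rewrite imset_f.
move=> _ /imsetP[x xA ->]; apply/forall_inP=> _ /imsetP[y yA ->].
by rewrite kjoin_relabel (forall_inP (H x xA)).
Qed.

(** All blocks lie over the image of [f], so taking preimages of blocks inverts
    the relabelling. *)
Lemma relabel_surj K A (P' : {set {set T + T}}) :
  P' \in diagrams K (f @: A) -> exists P, P' = relabel f P.
Proof.
rewrite inE => /and3P[/and3P[/eqP covP _ _] _ _].
exists [set vmap f @^-1: (B : {set T + T}) | B in P'].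
rewrite /relabel -imset_comp -[LHS]imset_id; apply: eq_in_imset => B BP /=.
apply/setP=> v; apply/idP/imsetP=> [vB|[u + ->]]; last by rewrite inE.
have : v \in cover P' by apply/bigcupP; exists B.
rewrite covP doubled_imset => /imsetP[u _ defv].
by exists u; rewrite // inE -defv.
Qed.

Lemma card_diagrams_imset K A : #|diagrams K (f @: A)| = #|diagrams K A|.
Proof.
rewrite -(card_imset _ relabel_inj); apply: eq_card => P'.
apply/idP/imsetP=> [P'A|[P PA ->]]; last by rewrite mem_diagrams_relabel.
have [P defP] := relabel_surj P'A.
by exists P; rewrite // -mem_diagrams_relabel -defP.
Qed.

Lemma card_irr_diagrams_imset K A :
  #|irr_diagrams K (f @: A)| = #|irr_diagrams K A|.
Proof.
rewrite -(card_imset _ relabel_inj); apply: eq_card => P'.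
apply/idP/imsetP=> [P'A|[P PA ->]]; last by rewrite mem_irr_diagrams_relabel.
have [P defP] : exists P, P' = relabel f P.
  by move: P'A; rewrite inE => /andP[/relabel_surj].
by exists P; rewrite // -mem_irr_diagrams_relabel -defP.
Qed.

End Relabel.

Lemma card_diagramsE K (T : finType) (A : {set T}) m :
  #|A| = m -> #|diagrams K A| = #|diagrams K [set: 'I_m]|.
Proof.
move=> <-; rewrite -(card_diagrams_imset enum_val_inj); congr #|diagrams K _|.
apply/setP=> x; apply/idP/imsetP=> [xA|[i _ ->]]; last exact: enum_valP.
by exists (enum_rank_in xA x); rewrite ?inE // enum_rankK_in.
Qed.

Lemma card_irr_diagramsE K (T : finType) (A : {set T}) m :
  #|A| = m -> #|irr_diagrams K A| = #|irr_diagrams K [set: 'I_m]|.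
Proof.
move=> <-; rewrite -(card_irr_diagrams_imset enum_val_inj).
congr #|irr_diagrams K _|.
apply/setP=> x; apply/idP/imsetP=> [xA|[i _ ->]]; last exact: enum_valP.
by exists (enum_rank_in xA x); rewrite ?inE // enum_rankK_in.
Qed.

(** The empty partition is the only one on no points, and all conditions on it are
    vacuous. *)
Lemma card_diagrams0 K : #|diagrams K [set: 'I_0]| = 1.
Proof.
have V0 (v : 'I_0 + 'I_0) : False by case: v => [[]|[]].
apply/eqP/cards1P; exists set0; apply/setP=> P; rewrite !inE.
apply/and3P/eqP=> [[/and3P[_ _ nP] _ _]|->{P}].
  apply/setP=> B; rewrite inE; apply: contraNF nP => BP.
  suff <- : B = set0 by [].
  by apply/setP=> v; case: (V0 v).
split.
- apply/and3P; split; last by rewrite inE.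
    by apply/eqP/setP=> v; case: (V0 v).
  by apply/trivIsetP=> B C; rewrite inE.
- by case: K => //=; apply/forall_inP=> B; rewrite inE.
- by apply/unithroughP; split=> [[]|[]|[]].
Qed.

(** Sum over the kernel class of the point [ord0].  A class of size m is
    determined by its other m - 1 points, chosen among n. *)
Lemma diagrams_recurrence K n :
  #|diagrams K [set: 'I_n.+1]| =
    \sum_(1 <= m < n.+2) 'C(n, m.-1) * #|irr_diagrams K [set: 'I_m]|
       * #|diagrams K [set: 'I_(n.+1 - m)]|.
Proof.
rewrite (card_diagrams_rec K (in_setT ord0)).
pose F m := #|irr_diagrams K [set: 'I_m]| * #|diagrams K [set: 'I_(n.+1 - m)]|.
transitivity (\sum_(B : {set 'I_n.+1} | ord0 \in B) F #|B|).
  apply: eq_big => [B|B _]; first by rewrite subsetT andbT.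
  rewrite (card_irr_diagramsE K (erefl #|B|)).
  rewrite (card_diagramsE K (m := n.+1 - #|B|)) //.
  by rewrite setTD cardsCs setCK card_ord.
(* Describe a class by its points other than [ord0]. *)
rewrite (reindex_onto (fun B : {set 'I_n.+1} => ord0 |: B)
  (fun B => B :\ ord0)); last first.
  by move=> B; apply: setD1K.
transitivity (\sum_(B : {set 'I_n.+1} | B \subset ~: [set ord0]) F #|B|.+1).
  have eqB (B : {set 'I_n.+1}) :
      (ord0 \in ord0 |: B) && ((ord0 |: B) :\ ord0 == B) = (B \subset ~: [set ord0]).
    rewrite setU11 /= subsetC sub1set inE.
    apply/eqP/idP=> [<-|/setU1K //]; by rewrite !inE eqxx.
  apply: eq_big => // B; rewrite eqB subsetC sub1set inE => nB.
  by rewrite cardsU1 nB.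
have le_card (B : {set 'I_n.+1}) : B \subset ~: [set ord0] -> #|B| < n.+1.
  by move/subset_leq_card; rewrite cardsC1 card_ord.
rewrite (partition_big (fun B : {set 'I_n.+1} => inord #|B| : 'I_n.+1) xpredT) //.
rewrite big_add1 /= big_mkord; apply: eq_bigr => i _.
rewrite -mulnA -/(F i.+1).
have <- : #|[set B : {set 'I_n.+1} | B \subset ~: [set ord0] & #|B| == i]| = 'C(n, i).
  by rewrite cards_draws cardsC1 card_ord.
rewrite -sum_nat_const; apply: eq_big => [B|B /andP[/le_card ltB /eqP<-]].
  rewrite inE; case sB: (B \subset _) => //=.
  by rewrite -val_eqE /= inordK // le_card.
by rewrite inordK.
Qed.

(** * Idempotents without floating component *)

Lemma blocks_trivIset n (a : setpart n) : trivIset (blocks a).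
Proof. by case/and3P: (valP a). Qed.

Lemma same_blockE n (a : setpart n) : same_block a =2 linked (blocks a).
Proof.
move=> u v; rewrite /same_block /=.
have covP : cover (blocks a) = setT by case/and3P: (valP a) => /eqP.
apply/idP/linkedP=> [uv|[B [BP uB vB]]].
  exists (pblock (blocks a) u); split=> //.
    by rewrite pblock_mem // covP inE.
  by rewrite mem_pblock covP inE.
by rewrite (def_pblock (blocks_trivIset a) BP uB).
Qed.

Lemma setpart_eqP n (a b : setpart n) : same_block a =2 same_block b -> a = b.
Proof.
move=> eqab; apply/val_inj.
rewrite -(equivalence_partition_pblock (valP a)).
rewrite -(equivalence_partition_pblock (valP b)).
by apply: eq_imset => u; apply/setP=> v; rewrite !inE; exact: eqab.
Qed.

Lemma ker_joinE n (a : setpart n) : ker_join a =2 kjoin (blocks a).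
Proof.
by apply: eq_connect => x y; rewrite /kstep -!same_blockE.
Qed.

Lemma gammaP n (a b : setpart n) u v :
  reflect (exists x y, linked (blocks a) x y /\ u = top_emb x /\ v = top_emb y
        \/ linked (blocks b) x y /\ u = bot_emb x /\ v = bot_emb y)
    (gamma a b u v).
Proof.
apply: (iffP orP).
  by case=> /existsP[x /existsP[y /and3P[]]]; rewrite same_blockE;
     move=> xy /eqP ux /eqP vy; exists x, y; auto.
case=> x [y [[xy [-> ->]]|[xy [-> ->]]]]; [left|right];
by apply/existsP; exists x; apply/existsP; exists y; rewrite same_blockE xy !eqxx.
Qed.

Lemma connect_top n (a b : setpart n) x y :
  linked (blocks a) x y -> connect (gamma a b) (top_emb x) (top_emb y).
Proof. by move=> xy; apply/connect1/gammaP; exists x, y; auto. Qed.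

Lemma connect_bot n (a b : setpart n) x y :
  linked (blocks b) x y -> connect (gamma a b) (bot_emb x) (bot_emb y).
Proof. by move=> xy; apply/connect1/gammaP; exists x, y; auto. Qed.

Lemma connect_gamma_sym n (a b : setpart n) : connect_sym (gamma a b).
Proof. exact/sym_connect_sym/gamma_sym. Qed.

Lemma connect_mid n (a : setpart n) x y :
  kjoin (blocks a) x y -> connect (gamma a a) (inr x) (inr y).
Proof.
pose p t := connect (gamma a a) (inr x) (inr t).
apply: (@connect_ind _ _ p) => [u v xu /orP[]|]; last exact: connect0.
  by move/(connect_bot a)/(connect_trans xu).
by move/(connect_top a)/(connect_trans xu).
Qed.

Lemma idempotentP n (a : setpart n) :
  reflect (forall x y,
      linked (blocks a) x y = connect (gamma a a) (inl x) (inl y))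
    (pmul a a == a).
Proof.
apply: (iffP eqP) => [aa x y|H]; first by rewrite -same_block_pmul aa same_blockE.
by apply: setpart_eqP => x y; rewrite same_block_pmul -H same_blockE.
Qed.

Lemma nfloat_eq0P n (a b : setpart n) :
  reflect (forall x, exists w, connect (gamma a b) (inr x) (inl w))
    (nfloat a b == 0).
Proof.
rewrite /nfloat cards_eq0; apply: (iffP eqP) => [no x|H].
  apply/existsP; apply: contra_eqT no => /existsPn nout.
  apply/set0Pn; exists [set v in [set: gvertex n] | connect (gamma a b) (inr x) v].
  rewrite inE imset_f ?inE //=; apply/subsetP=> -[w|y _]; last exact: imset_f.
  by rewrite !inE (negPf (nout w)).
apply/setP=> C; rewrite !inE; apply/negP=> /andP[/imsetP[z _ ->{C}] /subsetP sub].
have := sub z; rewrite !inE connect0 => /(_ isT)/imsetP[x _ defz].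
have [w xw] := H x; have := sub (inl w).
by rewrite !inE defz xw => /(_ isT)/imsetP[].
Qed.

(** Each floating component is the component of some middle vertex. *)
Lemma leq_nfloat n (a b : setpart n) : nfloat a b <= n.
Proof.
pose comp (x : 'I_n) := [set v in [set: gvertex n] | connect (gamma a b) (inr x) v].
rewrite -[leqRHS]card_ord -cardsT.
apply: leq_trans (leq_imset_card comp _); apply: subset_leq_card.
apply/subsetP=> C; rewrite inE => /andP[/imsetP[z _ ->{C}] /subsetP sub].
have := sub z; rewrite !inE connect0 => /(_ isT)/imsetP[x _ ->].
exact: imset_f.
Qed.

(** A path of the product graph from x to y' is confined to the kernel class of y in
    the middle row, the upper vertices joined to it in the first copy, and the lower
    vertices joined to it in the second copy.  As y' is joined in the second
    copy to a point t of the class, t lies in the through block of x and y'. *)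
Lemma idempotent_through n (a : setpart n) x y :
  pmul a a = a -> through (blocks a) x y -> kjoin (blocks a) x y.
Proof.
move/eqP/idempotentP=> idem xy; set P := blocks a in xy *.
have trP := linked_trans (blocks_trivIset a).
(* The set that confines the path; it contains x because y is in the class. *)
pose p (w : gvertex n) := match w with
  | inr t => kjoin P y t
  | inl (inl u) => [exists t, kjoin P y t && through P u t]
  | inl (inr v) => [exists t, kjoin P y t && through P t v]
  end.
have : p (inl (inr y)).
  have := xy; rewrite /through idem; apply: (@connect_ind _ _ p); last first.
    by apply/existsP; exists y; rewrite /kjoin connect0.
  move=> u0 v0 pu uv0; case/gammaP: uv0 pu => u [v [] [uv [-> ->]]].
    case: u uv => u; case: v => v uv /=.
    - case/existsP=> t /andP[yt ut]; apply/existsP; exists t; rewrite yt.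
      by apply: trP ut; rewrite linked_sym.
    - case/existsP=> t /andP[yt ut]; apply: (kjoin_trans yt); apply: connect1.
      by apply/orP; right; apply: trP uv; rewrite linked_sym.
    - by move=> yu; apply/existsP; exists u; rewrite yu /through linked_sym.
    - by move=> yu; apply: (kjoin_trans yu); apply: connect1; apply/orP; right.
  case: u uv => u; case: v => v uv /=.
  - by move=> yu; apply: (kjoin_trans yu); apply: connect1; apply/orP; left.
  - by move=> yu; apply/existsP; exists u; rewrite yu.
  - case/existsP=> t /andP[yt tu]; apply: (kjoin_trans yt); apply: connect1.
    by apply/orP; left; apply: trP tu uv.
  - case/existsP=> t /andP[yt tu]; apply/existsP; exists t; rewrite yt.
    exact: trP tu uv.
case/existsP=> t /andP[yt ty]; rewrite kjoin_sym; apply: (kjoin_trans yt).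
apply: connect1; apply/orP; left.
by apply: trP ty _; rewrite linked_sym.
Qed.

Lemma through_connect n (a : setpart n) x y :
  through (blocks a) x y ->
  connect (gamma a a) (inl (inl x)) (inr y) /\
  connect (gamma a a) (inr x) (inl (inr y)).
Proof. by split; [exact: (@connect_top _ a a (inl x) (inr y))
                 |exact: (@connect_bot _ a a (inl x) (inr y))]. Qed.

(** Without a through block, the kernel class of x spans a floating component of
    the middle row.  Two through blocks in one class are joined in the square
    by way of that class. *)
Lemma idempotent_unithrough n (a : setpart n) :
  pmul a a = a -> nfloat a a = 0 -> unithrough (blocks a) setT.
Proof.
move=> idem /eqP/nfloat_eq0P nfl.
have S x y : through (blocks a) x y -> kjoin (blocks a) x y.
  exact: idempotent_through.
have idP := idempotentP _ (introT eqP idem).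
apply/unithroughP; split=> //.
  move=> x _; have [w xw] := nfl x.
  suff /existsP[y /existsP[z /andP[xy yz]]] :
      [exists y, exists z, kjoin (blocks a) x y && through (blocks a) y z].
    by exists y, z.
  apply: contraLR isT => none.
  pose p (w : gvertex n) := if w is inr t then kjoin (blocks a) x t else false.
  have none_through y z : kjoin (blocks a) x y -> through (blocks a) y z -> False.
    move=> xy yz; case/negP: none; apply/existsP; exists y; apply/existsP.
    by exists z; rewrite xy.
  suff : p (inl w) by [].
  apply: (@connect_ind _ _ p) xw; last by rewrite /= /kjoin connect0.
  move=> u0 v0 pu uv0; case/gammaP: uv0 pu => u [v [] [uv [-> ->]]].
    case: u uv => u; case: v => v uv //= xu.
      have vu : through (blocks a) v u by rewrite /through linked_sym.
      case: (none_through v u) => //; apply: (kjoin_trans xu).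
      by rewrite kjoin_sym; exact: S.
    by apply: (kjoin_trans xu); apply: connect1; apply/orP; right.
  case: u uv => u; case: v => v uv //= xu.
    by apply: (kjoin_trans xu); apply: connect1; apply/orP; left.
  by case: (none_through u v).
move=> x y x' y' xx yy xy; rewrite idP.
have [cx _] := through_connect xx; have [cy _] := through_connect yy.
apply: (connect_trans cx).
apply: connect_trans (_ : connect _ (inr y') _).
  apply: connect_mid; apply: kjoin_trans (S _ _ yy).
  by apply: kjoin_trans xy; rewrite kjoin_sym; exact: S.
by rewrite connect_gamma_sym.
Qed.

(** The component of an outer vertex v consists of its block and, if that block is
    a through block, of the kernel class below it in the middle row; since the class has no other through block, no other outer vertex is
    reached. *)
Lemma unithrough_idempotent n (a : setpart n) :
  unithrough (blocks a) setT -> pmul a a = a.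
Proof.
case/unithroughP=> S _ U; apply/eqP/idempotentP => v w.
have trP := linked_trans (blocks_trivIset a).
have covP : cover (blocks a) = setT by case/and3P: (valP a) => /eqP.
have refl u : linked (blocks a) u u by rewrite linked_refl // covP inE.
apply/idP/idP.
  have mixed x y : through (blocks a) x y ->
      connect (gamma a a) (inl (inl x)) (inl (inr y)).
    move=> xy; have [cx cy] := through_connect xy.
    apply: (connect_trans cx); apply: connect_trans cy; apply: connect_mid.
    by rewrite kjoin_sym S.
  case: v w => x [] y xy.
  - exact: (@connect_top _ a a (inl x) (inl y)).
  - exact: mixed.
  - by rewrite connect_gamma_sym; apply: mixed; rewrite /through linked_sym.
  - exact: (@connect_bot _ a a (inr x) (inr y)).
(* The component of v. *)
pose p (z : gvertex n) := match z with
  | inl z => linked (blocks a) v z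
  | inr t => [exists x, exists y, [&& through (blocks a) x y,
       linked (blocks a) v (inl x) & kjoin (blocks a) x t]]
  end.
have pin x y t : through (blocks a) x y -> linked (blocks a) v (inl x) ->
    kjoin (blocks a) x t -> p (inr t).
  move=> xy vx xt; apply/existsP; exists x; apply/existsP; exists y.
  by rewrite xy vx.
suff : connect (gamma a a) (inl v) (inl w) -> p (inl w) by [].
apply: (@connect_ind _ _ p) => [u0 v0 pu uv0|]; last exact: refl.
case/gammaP: uv0 pu => u [z [] [uz [-> ->]]].
  case: u uz => u; case: z => z uz.
  - by move/trP; apply.
  - by move=> vu; apply: (pin u z) => //; exact: S.
  - case/existsP=> x /existsP[y /and3P[xy vx xu]].
    have zu : through (blocks a) z u by rewrite /through linked_sym.
    apply: (trP _ _ _ vx); apply: (U _ _ _ _ xy zu); apply: (kjoin_trans xu).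
    by rewrite kjoin_sym S.
  - case/existsP=> x /existsP[y /and3P[xy vx xu]].
    apply: (pin _ _ _ xy vx); apply: (kjoin_trans xu); apply: connect1.
    by apply/orP; right.
case: u uz => u; case: z => z uz.
- case/existsP=> x /existsP[y /and3P[xy vx xu]].
  apply: (pin _ _ _ xy vx); apply: (kjoin_trans xu); apply: connect1.
  by apply/orP; left.
- case/existsP=> x /existsP[y /and3P[xy vx xu]].
  by apply: (trP _ _ _ _ uz); apply: (trP _ _ _ vx); apply: (U _ _ _ _ xy uz).
- move=> vu.
  have zu : through (blocks a) z u by rewrite /through linked_sym.
  apply: (pin z u) => //; last by rewrite /kjoin connect0.
  by apply: trP vu _.
- by move/trP; apply.
Qed.

Lemma unithrough_nfloat n (a : setpart n) :
  unithrough (blocks a) setT -> nfloat a a = 0.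
Proof.
case/unithroughP=> S E _; apply/eqP/nfloat_eq0P => x.
have [y [z [xy yz]]] := E x (in_setT x); exists (inr z).
by apply: connect_trans (connect_mid xy) _; case: (through_connect yz).
Qed.

Lemma idempotent_nfloatE n (a : setpart n) :
  (pmul a a == a) && (nfloat a a == 0) = unithrough (blocks a) setT.
Proof.
apply/andP/idP => [[/eqP idem /eqP nfl]|H].
  exact: idempotent_unithrough.
by rewrite unithrough_idempotent // unithrough_nfloat.
Qed.

(** With a single kernel class, the transversals are all in that class, so
    having exactly one in each class means having rank 1.  For n = 0 there is no
    class, and the rank is 0. *)
Lemma irr_rank1E n (a : setpart n) : 0 < n -> pirreducible a ->
  (pmul a a == a) && (prank a == 1) = unithrough (blocks a) setT.
Proof.
move=> n_gt0 /forallP irr.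
have kj x y : kjoin (blocks a) x y.
  by rewrite -ker_joinE; move/forallP: (irr x); apply.
have tiP := blocks_trivIset a.
have through_block (x y : 'I_n) : through (blocks a) x y ->
    exists2 B : {set vertex n}, (inl x \in B) && (inr y \in B) & B \in [set B in blocks a |
      [exists x : 'I_n, inl x \in B] && [exists x : 'I_n, inr x \in B]].
  case/linkedP=> B [BP xB yB]; exists B; rewrite ?xB // inE BP /=.
  by apply/andP; split; apply/existsP; [exists x | exists y].
apply/andP/idP=> [[_ /cards1P[B defB]]|H].
  have : B \in [set B] by rewrite inE.
  rewrite -defB inE => /and3P[BP /existsP[x xB] /existsP[y yB]].
  apply/unithroughP; split=> [//|z _|x1 x2 y1 y2].
    by exists x, y; split=> //; apply/linkedP; exists B.
  move=> /through_block[B1 /andP[x1B _]]; rewrite defB inE => /eqP defB1.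
  move=> /through_block[B2 /andP[x2B _]]; rewrite defB inE => /eqP defB2 _.
  by apply/linkedP; exists B; split=> //; [rewrite -defB1 | rewrite -defB2].
split; first by rewrite unithrough_idempotent.
case/unithroughP: H => _ E U.
have [y [z [_ yz]]] := E (Ordinal n_gt0) (in_setT _).
have [B /andP[yB _] BB] := through_block _ _ yz.
apply/cards1P; exists B; apply/eqP; rewrite eqEsubset sub1set BB andbT.
apply/subsetP=> C; rewrite inE => /and3P[CP /existsP[u uC] /existsP[v vC]].
have uv : through (blocks a) u v by apply/linkedP; exists C.
have /linkedP[D [DP uD yD]] := U u y v z uv yz (kj u y).
have BP : B \in blocks a by move: BB; rewrite inE => /andP[].
rewrite inE -(def_pblock tiP CP uC) (def_pblock tiP DP uD).
by rewrite -(def_pblock tiP DP yD) (def_pblock tiP BP yB).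
Qed.

Local Open Scope ring_scope.
Import GRing.Theory Num.Theory.

(** Comparing coordinates at [a], an idempotent has a square equal to [a] and the
    power of xi equal to 1; an exponent that is at most n must then vanish. *)
Lemma xi_idempotentE (F : fieldType) (xi : F) n (a : setpart n) :
  root_order xi n = 0%N ->
  (palg_mul xi (pbasis F a) (pbasis F a) == pbasis F a) =
    (pmul a a == a) && (nfloat a a == 0%N).
Proof.
move=> /root_order_eq0P no_root; rewrite palg_mul_basis.
have bE c d : (pbasis F c d : F) = (d == c)%:R by rewrite unlock ffunE.
apply/eqP/andP=> [eqa|[/eqP-> /eqP->]]; last by rewrite expr0 scale1r.
have := congr1 (fun u : palg F n => (u a : F)) eqa.
rewrite ffunE /= !bE eqxx /GRing.scale /=.
case: eqP => [<-|_]; last by rewrite mulr0 => /esym/eqP; rewrite oner_eq0.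
rewrite mulr1 => xi1; split=> //; rewrite eqn0Ngt; apply/negP=> fl_gt0.
by case: no_root; exists (nfloat a a); rewrite fl_gt0 leq_nfloat.
Qed.

Local Close Scope ring_scope.

Lemma in_familyE K n (a : setpart n) : in_family K a = size_ok K (blocks a).
Proof. by case: K. Qed.

Lemma doubledT (T : finType) : doubled [set: T] = [set: T + T].
Proof. by apply/setP=> v; rewrite !inE. Qed.

Lemma card_setpart n (p : pred {set {set vertex n}}) :
  #|[set a : setpart n | p (blocks a)]| =
  #|[set P | partition P (doubled [set: 'I_n]) && p P]|.
Proof.
rewrite -(card_imset _ val_inj); apply: eq_card => P.
rewrite inE doubledT; apply/imsetP/andP=> [[a + ->]|[parP pP]].
  by rewrite inE; split=> //; exact: (valP a).
by exists (Sub P parP); rewrite ?inE.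
Qed.

Lemma e_xiE (F : fieldType) (xi : F) K n :
  root_order xi n = 0 -> e_xi xi K n = #|diagrams K [set: 'I_n]|.
Proof.
move=> hM; rewrite -(card_setpart (fun P => size_ok K P && unithrough P setT)).
apply: eq_card => a; rewrite !inE xi_idempotentE // idempotent_nfloatE.
by rewrite in_familyE.
Qed.

Lemma c1E K n : 0 < n -> c1 K n = #|irr_diagrams K [set: 'I_n]|.
Proof.
move=> n_gt0; pose irr P := [forall x : 'I_n in setT, forall y in setT, kjoin P x y].
pose p P := size_ok K P && unithrough P [set: 'I_n] && irr P.
transitivity #|[set a : setpart n | p (blocks a)]|; last first.
  by rewrite card_setpart; apply: eq_card => P; rewrite !inE /p !andbA.
apply: eq_card => a; rewrite !inE /p in_familyE -andbA; congr (_ && _).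
have -> : irr (blocks a) = pirreducible a.
  apply/forall_inP/forallP=> [H x|H x _].
    by apply/forallP=> y; rewrite ker_joinE (forall_inP (H x _)) ?inE.
  apply/forall_inP=> y _; rewrite -ker_joinE.
  by move/forallP: (H x); apply.
rewrite [RHS]andbC; case: (boolP (pirreducible a)) => //= irra.
exact: irr_rank1E.
Qed.

(** * The exponential formula *)

(** Lists rather than the dependent type, so that partitions of different integers
    can be compared. *)
Definition int_partitions n : seq (seq nat) :=
  [seq parts mu | mu <- index_enum (intpart n)].

Lemma mem_int_partitions n s : (s \in int_partitions n) = is_intpart n s.
Proof.
apply/mapP/idP=> [[mu _ ->]|/intpart_parts[mu <-]]; first exact: (valP mu).
by exists mu; rewrite ?mem_index_enum.
Qed.

Lemma uniq_int_partitions n : uniq (int_partitions n).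
Proof.
rewrite map_inj_uniq ?index_enum_uniq // => mu nu /(inj_map val_inj) eqv.
by do 2!apply: val_inj.
Qed.

Lemma geq_trans : transitive geq.
Proof. by move=> y x z /= yx zy; apply: leq_trans yx. Qed.

Lemma geq_anti : antisymmetric geq.
Proof. by move=> x y; rewrite andbC => /anti_leq. Qed.

Lemma sorted_geq_perm_eq s t : sorted geq s -> sorted geq t -> perm_eq s t -> s = t.
Proof. exact: sorted_eq geq_trans geq_anti _ _. Qed.

Lemma is_intpart_cons m n s t :
  0 < m <= n -> perm_eq s (m :: t) -> sorted geq s -> sorted geq t ->
  is_intpart n s = is_intpart (n - m) t.
Proof.
case/andP=> m_gt0 le_mn st ss tt; rewrite /is_intpart ss tt /=.
rewrite (perm_mem st) (perm_sumn st) inE negb_or eq_sym -lt0n m_gt0 /=.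
by congr (_ && _); rewrite -{1}(subnKC le_mn) eqn_add2l.
Qed.

Lemma sorted_rem (m : nat) s : sorted geq s -> sorted geq (rem m s).
Proof. exact/subseq_sorted/rem_subseq/geq_trans. Qed.

(** Removing a part m is a bijection onto the partitions of n - m; its inverse
    inserts m and sorts. *)
Lemma rem_int_partitions m n : 0 < m <= n ->
  perm_eq [seq rem m s | s <- int_partitions n & m \in s]
          (int_partitions (n - m)).
Proof.
move=> mn; apply: uniq_perm; last 1 first.
- move=> t; apply/mapP/idP=> [[s]|tP].
    rewrite mem_filter mem_int_partitions => /andP[ms sP] ->.
    have ss : sorted geq s by case/and3P: sP.
    rewrite mem_int_partitions -(is_intpart_cons mn (perm_to_rem ms)) //.
    exact: sorted_rem.
  rewrite mem_int_partitions in tP.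
  have tt : sorted geq t by case/and3P: tP.
  have st : perm_eq (sort geq (m :: t)) (m :: t) by rewrite perm_sort.
  have ss : sorted geq (sort geq (m :: t)).
    by apply: sort_sorted => x y; apply: leq_total.
  have ms : m \in sort geq (m :: t) by rewrite (perm_mem st) mem_head.
  exists (sort geq (m :: t)).
    by rewrite mem_filter ms mem_int_partitions (is_intpart_cons mn st).
  apply: sorted_geq_perm_eq => //; first exact: sorted_rem.
  rewrite -(perm_cons m) perm_sym -(permPr st) perm_sym.
  exact: perm_to_rem.
- rewrite map_inj_in_uniq ?filter_uniq ?uniq_int_partitions // => s t.
  rewrite !mem_filter !mem_int_partitions.
  move=> /andP[ms /and3P[ss _ _]] /andP[mt /and3P[st _ _]] eqst.
  apply: sorted_geq_perm_eq => //.
  by rewrite (permPl (perm_to_rem ms)) eqst perm_sym perm_to_rem.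
- exact: uniq_int_partitions.
Qed.

Lemma sumn_count_mem n s : all (fun i => i <= n) s ->
  sumn s = \sum_(1 <= m < n.+1) m * count_mem m s.
Proof.
elim: s => [_|x s IH /= /andP[xn /IH ->]].
  by rewrite big1 // => m _; rewrite muln0.
under [RHS]eq_bigr do rewrite mulnDr.
rewrite big_split /=; congr (_ + _).
case: x xn => [|x] xn.
  by rewrite big1 // => -[|m] _; rewrite ?mul0n ?muln0.
rewrite (bigD1_seq x.+1) ?iota_uniq ?mem_index_iota //= eqxx muln1 big1 ?addn0 //.
by move=> m; rewrite eq_sym => /negPf->; rewrite muln0.
Qed.

Lemma leq_intpart n s i : is_intpart n s -> i \in s -> i <= n.
Proof.
by case/and3P=> _ _ /eqP<- /perm_to_rem/perm_sumn->; rewrite /= leq_addr.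
Qed.

Local Open Scope ring_scope.

Definition part_weight (c : nat -> rat) (s : seq nat) (i : nat) : rat :=
  c i ^+ count_mem i s / ((count_mem i s)`!%:R * i`!%:R ^+ count_mem i s).

Definition intpart_sum (c : nat -> rat) n : rat :=
  \sum_(s <- int_partitions n) \prod_(1 <= i < n.+1) part_weight c s i.

Lemma part_weight0 c s i : i \notin s -> part_weight c s i = 1.
Proof. by move/count_memPn=> si; rewrite /part_weight si !expr0 fact0 mul1r mulr1 invr1. Qed.

Lemma factR_neq0 n : n`!%:R != 0 :> rat.
Proof. by rewrite pnatr_eq0 -lt0n fact_gt0. Qed.

Lemma part_weight_rem (c : nat -> rat) s m : m \in s -> (0 < m)%N ->
  (m * count_mem m s)%:R * part_weight c s m =
  c m / m.-1`!%:R * part_weight c (rem m s) m.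
Proof.
move=> ms; case: m ms => // m ms _; rewrite /part_weight.
have -> : count_mem m.+1 s = (count_mem m.+1 (rem m.+1 s)).+1.
  by rewrite (permP (perm_to_rem ms)) /= eqxx.
move: (count_mem _ _) => k; rewrite !exprS !factS !natrM.
have nz j : j.+1%:R != 0 :> rat by rewrite pnatr_eq0.
have cancel_km (a b d e x y z : rat) :
    a != 0 -> b != 0 -> d != 0 -> e != 0 -> z != 0 ->
    a * b * (y * x / (b * d * (a * e * z))) = y / e * (x / (d * z)).
  by move=> *; field; do ?[apply/andP; split].
by apply: cancel_km; rewrite ?expf_neq0 ?mulf_neq0 ?nz ?factR_neq0.
Qed.

(** Write n as the sum over m of m times the multiplicity of m; a partition with a
    part m contributes to the m-th term through the partition of n - m left
    after the removal of m. *)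
Lemma intpart_sum_rec c n :
  n%:R * intpart_sum c n =
  \sum_(1 <= m < n.+1) c m / m.-1`!%:R * intpart_sum c (n - m).
Proof.
rewrite /intpart_sum mulr_sumr.
transitivity (\sum_(s <- int_partitions n) \sum_(1 <= m < n.+1)
   (m * count_mem m s)%:R * \prod_(1 <= i < n.+1) part_weight c s i).
  apply: eq_big_seq => s; rewrite mem_int_partitions => sP.
  rewrite -mulr_suml -natr_sum -sumn_count_mem.
    by case/and3P: sP => _ _ /eqP->.
  by apply/allP=> i; apply: leq_intpart.
rewrite exchange_big /=; apply: eq_big_nat => m /andP[m_gt0 le_mn].
pose G t : rat := \prod_(1 <= i < n.+1) part_weight c t i.
transitivity (\sum_(s <- int_partitions n | m \in s)
     c m / m.-1`!%:R * G (rem m s)).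
  rewrite [RHS]big_mkcond; apply: eq_bigr => s _ /=.
  case: ifPn => [ms|/count_memPn->]; last by rewrite muln0 mul0r.
  rewrite /G !(bigD1_seq m) ?iota_uniq ?mem_index_iota ?m_gt0 //=.
  rewrite mulrA [RHS]mulrA -(part_weight_rem c ms m_gt0).
  congr (_ * _); apply: eq_bigr => i im.
  rewrite /part_weight; suff -> : count_mem i s = count_mem i (rem m s) by [].
  by rewrite (permP (perm_to_rem ms)) /= eq_sym (negPf im).
rewrite -mulr_sumr; congr (_ * _).
transitivity (\sum_(t <- [seq rem m s | s <- int_partitions n & m \in s]) G t).
  by rewrite [RHS]big_map big_filter.
rewrite (perm_big _ (rem_int_partitions _)) ?m_gt0 //.
apply: eq_big_seq => t; rewrite mem_int_partitions => tP.
rewrite /G (big_cat_nat (n := (n - m).+1)) ?ltnS ?leq_subr //=.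
rewrite [X in _ * X]big_nat [X in _ * X]big1 ?mulr1 // => i /andP[lt_i _].
rewrite part_weight0 //; apply: contraL lt_i => /(leq_intpart tP).
by rewrite -leqNgt.
Qed.

Lemma exponential_formula (c f : nat -> nat) :
  f 0%N = 1%N ->
  (forall n, f n.+1 =
     (\sum_(1 <= m < n.+2) 'C(n, m.-1) * c m * f (n.+1 - m))%N) ->
  forall n, (f n)%:R = n`!%:R * intpart_sum (fun i => (c i)%:R) n.
Proof.
move=> f0 fS n; have [k le_nk] := ubnP n; elim: k n le_nk => // k IH [|n] lt_nk.
  rewrite f0 fact0 mul1r /intpart_sum.
  have perm0 : perm_eq (int_partitions 0) [:: [::]].
    apply: uniq_perm => // [|s]; first exact: uniq_int_partitions.
    rewrite mem_int_partitions inE; case: s => // x s.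
    apply/negP=> /and3P[_]; rewrite inE negb_or /= addn_eq0.
    by case: x.
  by rewrite (perm_big _ perm0) /= big_seq1 big_geq.
rewrite factS natrM -mulrA mulrCA intpart_sum_rec mulr_sumr fS natr_sum.
apply: eq_big_nat => m /andP[m_gt0 le_mn].
case: m m_gt0 le_mn => // m _ le_mn; rewrite subSS /= !natrM IH; last first.
  by rewrite (leq_ltn_trans (leq_subr _ _)).
have le_mn' : (m <= n)%N by [].
rewrite -(bin_fact le_mn') !natrM.
have f1 := factR_neq0 m.
move: (intpart_sum _ _) (c _)%:R ('C(_, _)%:R) (m`!%:R) f1 => h x y z z0.
by move: ((n - m)`!%:R) => t; field.
Qed.

Theorem theorem35 (F : fieldType) (xi : F) (K : monoid_family) (n : nat)
    (hM : root_order xi n = 0%N) :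
  ((e_xi xi K n)%:R =
     n`!%:R * \sum_(mu : intpart n) \prod_(1 <= i < n.+1)
       ((c1 K i)%:R ^+ multiplicity mu i /
          ((multiplicity mu i)`!%:R * i`!%:R ^+ multiplicity mu i)) :> rat)
  /\ (e_xi xi K 0 = 1%N
      /\ ((1 <= n)%N ->
          e_xi xi K n =
            (\sum_(1 <= m < n.+1)
               'C(n.-1, m.-1) * c1 K m * e_xi xi K (n - m))%N)).
Proof.
have eE k : (k <= n)%N -> e_xi xi K k = #|diagrams K [set: 'I_k]|.
  move=> le_kn; apply: e_xiE; apply/root_order_eq0P => -[m [/andP[m0 mk] xim]].
  move/root_order_eq0P: hM; apply; exists m.
  by rewrite m0 (leq_trans mk).
have recD k : #|diagrams K [set: 'I_k.+1]| = (\sum_(1 <= m < k.+2)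
    'C(k, m.-1) * c1 K m * #|diagrams K [set: 'I_(k.+1 - m)]|)%N.
  rewrite diagrams_recurrence; apply: eq_big_nat => m /andP[m_gt0 _].
  by rewrite c1E.
have D0 : #|diagrams K [set: 'I_0]| = 1%N by exact: card_diagrams0.
split; last split.
- rewrite eE // (exponential_formula (f := fun k => #|diagrams K [set: 'I_k]|) D0 recD).
  by rewrite /intpart_sum big_map.
- by rewrite eE.
- case: n hM eE => // n _ eE _; rewrite eE // recD.
  by apply: eq_big_nat => m _; rewrite eE ?leq_subr.
Qed.
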